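(* Let $X$ be a compact metrizable space and let $d$ be a metric on $X$ inducing its topology. Let $\exp(X)$ be the space of nonempty closed subsets of $X$ with the Vietoris topology, and define $u_X:C(X)\to C(\exp(X))$ by $u_X(\phi)(A)=\sup\phi(A)$ for $\phi\in C(X)$, $A\in\exp(X)$ (and likewise for every compact metrizable space, in particular for $X\times X$). For $A,B\in\exp(X)$ let $$\tilde d(A,B)=\inf\{u_{X\times X}(d)(C)\mid C\in\exp(X\times X),\ pr_1(C)=A,\ pr_2(C)=B\}.$$ Then $\tilde d=d_H$, the Hausdorff metric on $\exp(X)$ associated with $d$.
   Context: $C(X)$ is the set of continuous real-valued functions on $X$; $pr_1,pr_2:X\times X\to X$ are the coordinate projections. The functor $\exp$ acts on continuous maps by taking images: $\exp(f)(A)=f(A)$. The Hausdorff metric is $d_H(A,B)=\inf\{\epsilon>0\mid A_\epsilon\supset B,\ B_\epsilon\supset A\}$, where $A_\epsilon=\{x\in X\mid d(x,A)\le\epsilon\}$ and $d(x,A)=\inf_{a\in A}d(x,a)$. *)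

(* Defs.v *)
From HB Require Import structures.
From mathcomp Require Import all_boot all_order all_algebra.
From mathcomp Require Import all_classical all_reals all_analysis.
From mathcomp Require Import lra.

Set Implicit Arguments.
Unset Strict Implicit.
Unset Printing Implicit Defensive.

Import Order.TTheory GRing.Theory Num.Theory.
Import numFieldTopology.Exports numFieldNormedType.Exports.

Local Open Scope classical_set_scope.
Local Open Scope ring_scope.

(* The hyperspace exp(X); its topology is the Vietoris one, declared below. *)
Record expSpace (X : topologicalType) := ExpSpace {
  exp_set :> set X;
  exp_closed : closed exp_set;
  exp_nonempty : exp_set !=set0
}.

HB.instance Definition _ (X : topologicalType) := gen_eqMixin (expSpace X).
HB.instance Definition _ (X : topologicalType) := gen_choiceMixin (expSpace X).

(* Subbase of the Vietoris topology: (true, U) stands for the closed sets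
   contained in U, and (false, U) for those that meet U. *)
Definition vietoris_subbase (X : topologicalType) (bU : bool * set X) :
    set (expSpace X) :=
  if bU.1 then [set A : expSpace X | A `<=` bU.2]
  else [set A : expSpace X | A `&` bU.2 !=set0].

HB.instance Definition _ (X : topologicalType) :=
  @isSubBaseTopological.Build (expSpace X) (bool * set X)%type
    [set bU | open bU.2] (@vietoris_subbase X).

Lemma open_vietoris_subbase (X : topologicalType) (b : bool) (U : set X) :
  open U -> open (vietoris_subbase (b, U)).
Proof.
move=> oU; exists [set vietoris_subbase (b, U)]; last by rewrite bigcup_set1.
by move=> _ ->; apply: finI_from1.
Qed.

Section sup_functional.
Context {R : realType} {X : topologicalType} (cptX : compact [set: X]).
Implicit Type phi : continuousType X R.

Lemma has_sup_image phi (A : expSpace X) : has_sup (phi @` A).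
Proof.
split; first by have [x Ax] := exp_nonempty A; exists (phi x), x.
have cA : compact (exp_set A).
  by apply: (subclosed_compact _ cptX) => //; exact: exp_closed.
have cphiA : compact (phi @` A).
  apply: (continuous_compact _ cA); apply: continuous_subspaceT.
  exact: cts_fun.
have [M [_ HM]] := compact_bounded cphiA.
exists (M + 1) => y /(HM _ (ltr_pwDr ltr01 (lexx M))).
by apply: le_trans; exact: ler_norm.
Qed.

Lemma continuous_sup_image phi :
  continuous (fun A : expSpace X => sup (phi @` A) : R).
Proof.
move=> A; have FA : Filter (nbhs A) by exact: nbhs_filter.
apply/cvgrPdist_le => e e0.
have hsA := has_sup_image phi A.
have ctsphi := @cts_fun _ _ phi.
have oU : open (vietoris_subbase (true, phi @^-1` [set y | y < sup (phi @` A) + e])).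
  apply: open_vietoris_subbase; apply: open_comp; last exact: open_lt.
  by move=> x _; exact: ctsphi.
have oV : open (vietoris_subbase (false, phi @^-1` [set y | sup (phi @` A) - e < y])).
  apply: open_vietoris_subbase; apply: open_comp; last exact: open_gt.
  by move=> x _; exact: ctsphi.
have AU : vietoris_subbase (true, phi @^-1` [set y | y < sup (phi @` A) + e]) A.
  move=> x Ax /=; apply: (@le_lt_trans _ _ (sup (phi @` A))); last by rewrite ltrDl.
  by apply: ub_le_sup; [exact: hsA.2 | exists x].
have AV : vietoris_subbase (false, phi @^-1` [set y | sup (phi @` A) - e < y]) A.
  by have [_ [x Ax <-] xe] := sup_adherent e0 hsA; exists x.
have nU := open_nbhs_nbhs (conj oU AU).
have nV := open_nbhs_nbhs (conj oV AV).
near=> B.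
have BU : vietoris_subbase (true, phi @^-1` [set y | y < sup (phi @` A) + e]) B.
  by near: B; exact: nU.
have [x [Bx xV]] : vietoris_subbase (false, phi @^-1` [set y | sup (phi @` A) - e < y]) B.
  by near: B; exact: nV.
have hsB := has_sup_image phi B.
rewrite ler_distl; apply/andP; split.
  rewrite lerBlDr; apply: ge_sup; first exact: hsB.1.
  by move=> _ [y /BU yU <-]; exact: ltW.
rewrite -lerBlDr; apply: (le_trans (ltW xV)).
by apply: ub_le_sup; [exact: hsB.2 | exists x].
Unshelve. all: by end_near. Qed.

End sup_functional.

(* Compactness of X makes the supremum finite and continuous in A, so that u_X
   takes its values in C(exp(X)). *)
Definition uX (R : realType) (X : topologicalType) (cptX : compact [set: X])
    (phi : continuousType X R) : continuousType (expSpace X) R :=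
  mkcts (@continuous_sup_image R X cptX phi).

Lemma compact_prodT (X Y : topologicalType) :
  compact [set: X] -> compact [set: Y] -> compact [set: (X * Y)%type].
Proof. by rewrite -setXTT; exact: compact_setX. Qed.

Section metric.
Context {R : realType} {X : metricType R}.
Implicit Types A B : expSpace X.

Lemma continuous_mdist : continuous (fun p : X * X => mdist p.1 p.2 : R).
Proof.
case=> x y; apply/cvgrPdist_le => e e0.
have e20 : 0 < e / 2 by rewrite divr_gt0.
near=> p.
have [xp yp] : mdist x p.1 < e / 2 /\ mdist y p.2 < e / 2.
  near: p; exists (ball x (e / 2), ball y (e / 2)) => /=.
    by split; exact: nbhsx_ballx.
  by move=> [a b] []; rewrite /= !ballEmdist.
have t1 := metric_triangle x p.1 y.
have t2 := metric_triangle p.1 p.2 y.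
have t3 := metric_triangle p.1 x p.2.
have t4 := metric_triangle x y p.2.
have s1 := metric_sym p.1 x; have s2 := metric_sym p.2 y.
rewrite ler_distl /=; apply/andP; split; lra.
Unshelve. all: by end_near. Qed.

Definition dist_cts : continuousType (X * X)%type R := mkcts continuous_mdist.

(* exp acts on maps by images, so exp(pr_i)(C) has underlying set pr_i(C).
   The library's real inf is 0 on the empty set; for A, B in exp(X) with X compact,
   every inf in this section is over a nonempty set bounded below by 0. *)
Definition d_tilde (cptX : compact [set: X]) A B : R :=
  inf [set uX (compact_prodT cptX cptX) dist_cts C | C in
        [set C : expSpace (X * X)%type |
          fst @` C = A /\ snd @` C = B]].

Definition dist_to (x : X) (A : set X) : R := inf [set mdist x a | a in A].

Definition cthickening (A : set X) (e : R) : set X :=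
  [set x | dist_to x A <= e].

Definition hausdorff_dist A B : R :=
  inf [set e : R | [/\ 0 < e, B `<=` cthickening A e
                     & A `<=` cthickening B e]].

End metric.

(* Main.v *)
Require Import Defs.
From mathcomp Require Import all_boot all_order all_algebra.
From mathcomp Require Import all_classical all_reals all_analysis.

(** A closed set C with projections A and B and sup d(C) <= e matches every
    point of A to a point of B at distance at most e and vice versa, so every
    e' > e is admissible for the Hausdorff distance. Conversely, if e is
    admissible then, for every e' > e, the set of pairs of A x B at distance at
    most e' is closed and projects onto A and B. *)

Set Implicit Arguments.
Unset Strict Implicit.
Unset Printing Implicit Defensive.

Import Order.TTheory GRing.Theory Num.Theory.

Local Open Scope classical_set_scope.
Local Open Scope ring_scope.

Section dist_to.
Context {R : realType} {X : metricType R}.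
Implicit Types (x y : X) (A : set X) (e : R).

Lemma has_lbound_mdist x A : has_lbound [set mdist x a | a in A].
Proof. by exists 0 => _ [a _ <-]; exact: mdist_ge0. Qed.

Lemma dist_to_le x y A : A y -> dist_to x A <= mdist x y.
Proof. by move=> Ay; apply: ge_inf; [exact: has_lbound_mdist | exists y]. Qed.

(** The infimum may not be attained, but a strict bound leaves the slack [e - dist_to x A] for a
    point of [A] to fit in. *)
Lemma dist_to_adherent x A e :
  A !=set0 -> dist_to x A < e -> exists2 y, A y & mdist x y < e.
Proof.
move=> [a Aa] xAe.
have infA : has_inf [set mdist x a | a in A].
  by split; [exists (mdist x a), a | exact: has_lbound_mdist].
have e0 : 0 < e - dist_to x A by rewrite subr_gt0.
have [_ [y Ay <-]] := inf_adherent e0 infA.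
by rewrite -/(dist_to x A) addrC subrK => xye; exists y.
Qed.

End dist_to.

Section coupling.
Context {R : realType} {X : metricType R} (cptX : compact [set: X]).
Implicit Types (A B : expSpace X) (C : expSpace (X * X)%type) (e : R).

Let cptXX := compact_prodT cptX cptX.

Definition couples A B C := fst @` C = A /\ snd @` C = B.

Lemma mdist_le_uX C x y : exp_set C (x, y) -> mdist x y <= uX cptXX dist_cts C.
Proof.
move=> Cxy; apply: ub_le_sup; last by exists (x, y).
by have [] := has_sup_image cptXX dist_cts C.
Qed.

Lemma uX_dist_le C e :
  (forall x y, exp_set C (x, y) -> mdist x y <= e) -> uX cptXX dist_cts C <= e.
Proof.
move=> Ce; apply: ge_sup; last by move=> _ [[x y] /Ce xye <-].
by have [] := has_sup_image cptXX dist_cts C.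
Qed.

Lemma uX_dist_ge0 C : 0 <= uX cptXX dist_cts C.
Proof.
have [[x y] Cxy] := exp_nonempty C.
exact: le_trans (mdist_ge0 x y) (mdist_le_uX Cxy).
Qed.

Lemma couples_thickening A B C e :
  couples A B C -> uX cptXX dist_cts C <= e ->
  B `<=` cthickening A e /\ A `<=` cthickening B e.
Proof.
move=> [CA CB] Ce; split=> z.
  rewrite -{1}CB => -[[x y] Cxy /= <-].
  have Ax : exp_set A x by rewrite -CA; exists (x, y).
  apply: le_trans (dist_to_le y Ax) _.
  by rewrite metric_sym; apply: le_trans Ce; exact: mdist_le_uX.
rewrite -{1}CA => -[[x y] Cxy /= <-].
have By : exp_set B y by rewrite -CB; exists (x, y).
apply: le_trans (dist_to_le x By) _.
by apply: le_trans Ce; exact: mdist_le_uX.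
Qed.

(** The largest candidate: it contains every coupling of [A] and [B] with supremum at most [e].
    Written with preimages so that closedness follows from continuity. *)
Definition near_pairs A B e : set (X * X) :=
  (fst @^-1` A `&` snd @^-1` B) `&` dist_cts @^-1` [set r | r <= e].

Lemma closed_near_pairs A B e : closed (near_pairs A B e).
Proof.
apply: closedI; first apply: closedI.
- by apply: preimage_closed; [move=> p _; exact: cvg_fst | exact: exp_closed].
- by apply: preimage_closed; [move=> p _; exact: cvg_snd | exact: exp_closed].
- apply: (preimage_closed _ (@closed_le R e)) => p _.
  exact: continuous_mdist.
Qed.

Lemma couples_of_matching A B e :
  (forall x, exp_set A x -> exists2 y, exp_set B y & mdist x y <= e) ->
  (forall y, exp_set B y -> exists2 x, exp_set A x & mdist x y <= e) ->
  exists2 C, couples A B C & uX cptXX dist_cts C <= e.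
Proof.
move=> AB BA.
have near_neq0 : near_pairs A B e !=set0.
  by have [x Ax] := exp_nonempty A; have [y By xye] := AB x Ax; exists (x, y).
exists (ExpSpace (@closed_near_pairs A B e) near_neq0); last first.
  by apply: uX_dist_le => x y [].
(* The projections land in [A] and [B] by construction; the two matchings give surjectivity. *)
split; apply/seteqP; split=> [_ [[x y] [[Ax By] _] <-] //|z].
  by move=> Az; have [y By zye] := AB z Az; exists (z, y).
by move=> Bz; have [x Ax xze] := BA z Bz; exists (x, z).
Qed.

(** The gap between [e] and [e'] makes the bounds on [dist_to] strict, so that every point gets an
    actual partner. *)
Lemma couples_of_thickening A B e e' : e < e' ->
  B `<=` cthickening A e -> A `<=` cthickening B e ->
  exists2 C, couples A B C & uX cptXX dist_cts C <= e'.
Proof.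
move=> ee' BA AB; apply: couples_of_matching => [x Ax|y By].
  have [y By xye] := dist_to_adherent (exp_nonempty B) (le_lt_trans (AB x Ax) ee').
  by exists y => //; exact: ltW.
have [x Ax yxe] := dist_to_adherent (exp_nonempty A) (le_lt_trans (BA y By) ee').
by exists x => //; rewrite metric_sym; exact: ltW.
Qed.

(** Keeps the infima below away from the empty set, where [inf] defaults to 0. By compactness
    [mdist] has a bound [M] on the whole square, and at threshold [M] any two points match. *)
Lemma exists_couples A B : exists C, couples A B C.
Proof.
have [_ [M HM]] : has_sup (dist_cts @` [set: X * X]).
  have [a Aa] := exp_nonempty A.
  have ne : [set: X * X] !=set0 by exists (a, a).
  exact: (has_sup_image cptXX dist_cts (ExpSpace closedT ne)).
have HM' (x y : X) : mdist x y <= M by apply: HM; exists (x, y).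
have [a Aa] := exp_nonempty A; have [b Bb] := exp_nonempty B.
have [C ABC _] : exists2 C, couples A B C & uX cptXX dist_cts C <= M.
  by apply: couples_of_matching => z _; [exists b | exists a].
by exists C.
Qed.

End coupling.

Theorem theorem2 (R : realType) (X : metricType R) (cptX : compact [set: X]) :
  d_tilde cptX = @hausdorff_dist R X.
Proof.
apply/funext => A; apply/funext => B; apply/eqP; rewrite eq_le.
have [C0 ABC0] := exists_couples cptX A B.
(* Strictness secures [0 < e], as the supremum over [C] can be 0. *)
have admissible C e : couples A B C ->
    uX (compact_prodT cptX cptX) dist_cts C < e ->
    [/\ 0 < e, B `<=` cthickening A e & A `<=` cthickening B e].
  move=> ABC Ce; have [BA AB] := couples_thickening ABC (ltW Ce).
  by split=> //; exact: le_lt_trans (uX_dist_ge0 cptX C) Ce.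
apply/andP; split.
  (* [d_tilde] is at most each admissible [e], up to an arbitrary [d > 0]; adding 1 to the supremum
     over [C0] gives one admissible value. *)
  apply: lb_le_inf => [|e [_ BA AB]].
    by exists (uX (compact_prodT cptX cptX) dist_cts C0 + 1);
       apply: admissible ABC0 _; rewrite ltrDl.
  apply/ler_addgt0Pr => d d0.
  have [|C ABC Ce] := @couples_of_thickening _ _ cptX A B e (e + d) _ BA AB.
    by rewrite ltrDl.
  apply: le_trans Ce; apply: ge_inf; last by exists C.
  by exists 0 => _ [D _ <-]; exact: uX_dist_ge0.
(* Conversely, for each coupling [C], its supremum plus any [d > 0] is admissible. *)
apply: lb_le_inf => [|_ [C ABC <-]].
  by exists (uX (compact_prodT cptX cptX) dist_cts C0), C0.
apply/ler_addgt0Pr => d d0; apply: ge_inf; first by exists 0 => e [/ltW].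
by apply: admissible ABC _; rewrite ltrDl.
Qed.
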